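(* The invariant set (taken to be the set of equilibria) of the closed-loop system $\dot\xi=\hat f(\xi)$ on $\mathcal M$ is given by $$\Xi=\Big\{\bar\xi\in\mathcal M:\ 2\bar\alpha_i+\bar\beta_i=\pi \bmod 2\pi\ \text{ and }\ \exists\,\bar s\ \text{ s.t. }\ \frac{\sin\bar\alpha_i}{\bar\rho_i}=\bar s,\ \forall i\in\{1,\ldots,n\}\Big\}.$$ At such an equilibrium the unicycles travel at angular speed $\bar\omega=2v\bar s$. A circular formation is realized whenever $\bar s\neq0$: counterclockwise for $\bar s>0$ and clockwise for $\bar s<0$. Otherwise (if $\bar s=0$) a collinear formation is realized: the unicycles travel along a line at the same forward speed.
   Context: $n\ge2$ unicycles with positions $z_i=[x_i,y_i]^\top$, headings $\theta_i$, and dynamics $\dot x_i=v\cos\theta_i$, $\dot y_i=v\sin\theta_i$, $\dot\theta_i=\omega_i$ with fixed common $v>0$, in cyclic pursuit ($i$ pursues $i+1$, indices modulo $n$), without overlap. Relative coordinates $\xi_i=[\rho_i,\alpha_i,\beta_i]^\top$: $\rho_i>0$ is the distance between $i$ and $i+1$, $\alpha_i$ the angle from $i$'s heading to the direction of $z_{i+1}-z_i$, $\beta_i=\theta_i-\theta_{i+1}-\pi$; $\xi=[\xi_1^\top,\ldots,\xi_n^\top]^\top\in\mathbb R^{3n}$. Angles are understood modulo $2\pi$. Control law, with gain $k\neq0$: $\omega_i=\frac{2v}{\rho_i}\sin\alpha_i+\frac{k}{\rho_i}(\cos\alpha_i+\cos(\alpha_i+\beta_i))$. The closed-loop system $\dot\xi=\hat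 f(\xi)$ is $$\dot\rho_i=-v(\cos\alpha_i+\cos(\alpha_i+\beta_i)),$$ $$\dot\alpha_i=\tfrac{v}{\rho_i}(\sin(\alpha_i+\beta_i)-\sin\alpha_i)-\tfrac{k}{\rho_i}(\cos\alpha_i+\cos(\alpha_i+\beta_i)),$$ $$\dot\beta_i=\omega_i-\omega_{i+1}.$$ $\mathcal M=\{\xi\in\mathbb R^{3n}: g(\xi)=0\}$, where $g=[g_1,g_2,g_3]^\top$ and, with $\gamma_i=(i-1)\pi-\sum_{j=1}^{i-1}\beta_j$, $g_1=\sum_i\rho_i\sin(\alpha_i+\gamma_i)$, $g_2=\sum_i\rho_i\cos(\alpha_i+\gamma_i)$, $g_3=\sum_i\beta_i+n\pi$ (the last equation taken modulo $2\pi$). These constraints hold for every configuration of the unicycles. Circular formation: the unicycles travel along a common circle at the same angular speed. *)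

(* Defs.v *)
From HB Require Import structures.
From mathcomp Require Import all_boot all_order all_algebra.
From mathcomp Require Import all_classical all_reals all_analysis.

Set Implicit Arguments.
Unset Strict Implicit.
Unset Printing Implicit Defensive.

Import Order.TTheory GRing.Theory Num.Theory.
Import numFieldNormedType.Exports.

Local Open Scope classical_set_scope.
Local Open Scope ring_scope.

Definition eqmod2pi (R : realType) (a b : R) : Prop :=
  exists m : int, a = b + m%:~R * (2 * pi).

(* A point xi of R^{3n} is stored as an n x 3 matrix whose i-th row is
   (rho_i, alpha_i, beta_i). Vehicles are numbered 0, ..., n-1, and vehicle i
   pursues vehicle ordS i, i.e. i + 1 modulo n. *)
Section RelativeCoordinates.
Variables (R : realType) (n : nat).
Implicit Types (xi : 'M[R]_(n, 3)) (i : 'I_n) (v k : R).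

Definition rho xi i : R := xi i 0.
Definition alpha xi i : R := xi i 1.
Definition beta xi i : R := xi i 2%:R.

Definition omega v k xi i : R :=
  2 * v / rho xi i * sin (alpha xi i)
  + k / rho xi i * (cos (alpha xi i) + cos (alpha xi i + beta xi i)).

Definition fhat v k xi : 'M[R]_(n, 3) := \matrix_(i < n, j < 3)
  nth 0
    [:: - v * (cos (alpha xi i) + cos (alpha xi i + beta xi i));
        v / rho xi i * (sin (alpha xi i + beta xi i) - sin (alpha xi i))
        - k / rho xi i * (cos (alpha xi i) + cos (alpha xi i + beta xi i));
        omega v k xi i - omega v k xi (ordS i)] j.

(* The usual (i - 1) pi - sum_{j < i} beta_j, for 1-based i, with indices
   shifted by one. *)
Definition gamma xi i : R :=
  i%:R * pi - \sum_(j < n | (j < i)%N) beta xi j.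

Definition g1 xi : R := \sum_(i < n) rho xi i * sin (alpha xi i + gamma xi i).
Definition g2 xi : R := \sum_(i < n) rho xi i * cos (alpha xi i + gamma xi i).
Definition g3 xi : R := \sum_(i < n) beta xi i + n%:R * pi.

(* The requirement rho_i > 0 (no overlap) is part of the state space: fhat is
   undefined at rho_i = 0. *)
Definition manifoldM : set 'M[R]_(n, 3) :=
  [set xi | [/\ forall i, 0 < rho xi i,
                g1 xi = 0, g2 xi = 0 & eqmod2pi (g3 xi) 0]].

Definition equilibria v k : set 'M[R]_(n, 3) :=
  [set xi | manifoldM xi /\ fhat v k xi = 0].

Definition Xi : set 'M[R]_(n, 3) :=
  [set xi | [/\ manifoldM xi,
                forall i, eqmod2pi (2 * alpha xi i + beta xi i) pi
              & exists s : R, forall i, sin (alpha xi i) / rho xi i = s]].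

End RelativeCoordinates.

Record config (R : realType) (n : nat) := Config {
  xpos : 'I_n -> R;
  ypos : 'I_n -> R;
  heading : 'I_n -> R }.

Section Motions.
Variables (R : realType) (n : nat).
Implicit Types (c : config R n) (q : R -> config R n) (xi : 'M[R]_(n, 3)).

(* xi is a vector of relative coordinates of c. As angles are only meaningful
   modulo 2 pi, this is a relation and not a function of c. *)
Definition relcoords c xi : Prop := forall i : 'I_n,
  let dx := xpos c (ordS i) - xpos c i in
  let dy := ypos c (ordS i) - ypos c i in
  [/\ 0 < rho xi i,
      rho xi i = Num.sqrt (dx ^+ 2 + dy ^+ 2),
      dx = rho xi i * cos (heading c i + alpha xi i),
      dy = rho xi i * sin (heading c i + alpha xi i)
    & eqmod2pi (beta xi i) (heading c i - heading c (ordS i) - pi)].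

(* Solutions on [0, +oo[ of the unicycle dynamics under the control law.
   The choice of xi among the relative coordinates of q t is immaterial, since
   omega is 2 pi-periodic in the angles. Values of q at negative times only
   serve to make the two-sided derivative at 0 meaningful. *)
Definition closed_loop (v k : R) q : Prop := forall t : R, 0 <= t ->
  exists2 xi, relcoords (q t) xi & forall i : 'I_n,
    [/\ is_derive t 1 (fun u : R => xpos (q u) i)
          (v * cos (heading (q t) i)),
        is_derive t 1 (fun u : R => ypos (q u) i)
          (v * sin (heading (q t) i))
      & is_derive t 1 (fun u : R => heading (q u) i) (omega v k xi i)].

(* All vehicles travel on a common circle with signed angular speed w. *)
Definition circular_formation (w : R) q : Prop :=
  w != 0 /\
  exists cx cy r : R, 0 < r /\
    forall i : 'I_n, exists phi : R, forall t : R, 0 <= t ->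
      xpos (q t) i = cx + r * cos (phi + w * t) /\
      ypos (q t) i = cy + r * sin (phi + w * t).

Definition counterclockwise_circular_formation q : Prop :=
  exists2 w : R, 0 < w & circular_formation w q.

Definition clockwise_circular_formation q : Prop :=
  exists2 w : R, w < 0 & circular_formation w q.

(* All vehicles travel along a common line, of direction phi, and their common
   heading is phi, so that u is their common forward speed. *)
Definition collinear_formation (u : R) q : Prop :=
  exists px py phi : R,
    forall i : 'I_n, exists a : R, forall t : R, 0 <= t ->
      [/\ xpos (q t) i = px + (a + u * t) * cos phi,
          ypos (q t) i = py + (a + u * t) * sin phi
        & eqmod2pi (heading (q t) i) phi].

End Motions.

(* Main.v *)
Require Import Defs.
From mathcomp Require Import all_boot all_order all_algebra.
From mathcomp Require Import all_classical all_reals all_analysis.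
From mathcomp Require Import ring lra.
Import Order.TTheory GRing.Theory Num.Theory.
Import numFieldNormedType.Exports.
Local Open Scope classical_set_scope.
Local Open Scope ring_scope.

(* At an equilibrium the equation for rho forces cos (alpha + beta) = - cos alpha,
   and the equation for alpha then forces sin (alpha + beta) = sin alpha, so that
   omega_i = 2 v sin alpha_i / rho_i.

   To show that a solution starting at an equilibrium keeps its relative
   coordinates, describe vehicle i by the polynomial coordinates a = rho cos alpha,
   b = rho sin alpha, P = cos d and Q = sin d, where d is the heading of vehicle
   i + 1 minus that of vehicle i. Then a' = v (P - 1) + omega_i b,
   b' = v Q - omega_i a, d' = omega_{i+1} - omega_i, and omega_i is a rational
   function of a, b, P, Q with denominator a^2 + b^2 = rho^2. The squared distance
   to the equilibrium satisfies E' <= K E with K continuous in time, so E = 0 by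
   Gronwall. The turning rates are then constantly 2 v s and the trajectories
   are integrated explicitly. *)

Set Implicit Arguments.
Unset Strict Implicit.

(** * Angles modulo [2 * pi] and indices on a cycle *)

(** Removing full turns leaves [z] in [[0, 2 * pi[]; then [z] or [2 * pi - z] lies in [[0, pi]],
    where cosine is injective. *)
Lemma cos_eq1_mod2pi (R : realType) (x : R) : cos x = 1 -> eqmod2pi x 0.
Proof.
move=> cx1; have p0 : 0 < pi *+ 2 :> R by rewrite pmulrn_lgt0 ?pi_gt0.
pose m := Num.floor (x / (pi *+ 2)); exists m.
pose z : R := x - m%:~R * (pi *+ 2).
have z0 : 0 <= z by rewrite /z subr_ge0 -ler_pdivlMr// /m Num.Theory.ge_floor.
have z2 : z < pi *+ 2.
  rewrite /z ltrBlDr -{1}[pi *+ 2]mul1r -mulrDl -ltr_pdivrMr//.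
  by rewrite addrC -(intrD _ m 1) Num.Theory.floorD1_gt.
have cz : cos z = 1.
  rewrite /z; case: (m) => j.
    by rewrite -{2}cx1 -[X in _ = cos X](subrK (j%:~R * (pi *+ 2))) -pmulrn
      [j%:R * _]mulr_natl (periodicn (@cosD2pi R)).
  rewrite NegzE mulrNz mulNr opprK -pmulrn mulr_natl.
  by rewrite (periodicn (@cosD2pi R)).
suff z00 : z = 0 by move/eqP: z00; rewrite /z subr_eq add0r => /eqP ->;
  rewrite add0r mulr_natl.
have pi0 := pi_gt0 R.
have [zp|zp] := leP z pi.
  by apply: (@cos_inj R); rewrite ?in_itv/= ?z0 ?zp ?lexx ?pi_ge0 ?cos0.
have : pi *+ 2 - z = 0 :> R; last by lra.
apply: (@cos_inj R); rewrite ?in_itv/= ?lexx ?pi_ge0 //; first by lra.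
by rewrite cosB cos2pi sin2pi mul1r mul0r addr0 cos0.
Qed.

(** Trades congruences for equations that [ring] and [lra] can use. Conversely, these equations give
    [cos (a - b) = 1]. *)
Lemma eqmod2piP (R : realType) (a b : R) :
  eqmod2pi a b <-> cos a = cos b /\ sin a = sin b.
Proof.
split=> [[m ->]|[ca sa]].
  rewrite mulr_natl; case: m => j.
    by rewrite -pmulrn mulr_natl (periodicn (@cosD2pi R)) (periodicn (@sinD2pi R)).
  rewrite NegzE mulrNz mulNr -pmulrn mulr_natl.
  by rewrite -(periodicn (@cosD2pi R) j.+1) -(periodicn (@sinD2pi R) j.+1) subrK.
have : cos (a - b) = 1 by rewrite cosB ca sa -!expr2 cos2Dsin2.
move=> /cos_eq1_mod2pi[m]; rewrite add0r => /eqP.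
by rewrite subr_eq addrC => /eqP ->; exists m.
Qed.

(** Iterating [ordS] from [ord0] reaches every index. Hence whatever each vehicle shares with its
    target (the value [s], the centre of the circle, the line) is common to all. *)
Lemma ordS_invariant (n : nat) (T : Type) (f : 'I_n -> T) :
  (forall i, f (ordS i) = f i) -> forall i j, f i = f j.
Proof.
case: n f => [f _ []//|n f fS].
suff H m (mn : (m < n.+1)%N) : f (Ordinal mn) = f ord0.
  by case=> i hi [j hj]; rewrite !H.
elim: m mn => [|m IH] mn; first by congr (f _); apply: val_inj.
rewrite -(IH (ltnW mn)) -[RHS]fS; congr (f _); apply: val_inj => /=.
by rewrite modn_small.
Qed.

(** At the last index [ordS] wraps to 0, where the partial sum is empty; the correction term removes
    the full sum there. *)
Lemma sum_ltn_ordS (V : zmodType) (n : nat) (u : 'I_n -> V) (i : 'I_n) :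
  \sum_(j < n | (j < ordS i)%N) u j =
  \sum_(j < n | (j < i)%N) u j + u i - \sum_(j < n) u j *+ (i.+1 == n).
Proof.
have S : \sum_(j < n | (j < i.+1)%N) u j = \sum_(j < n | (j < i)%N) u j + u i.
  rewrite (bigD1 i) ?ltnSn//= addrC; congr (_ + _); apply: eq_bigl => j.
  by rewrite ltnS ltn_neqAle andbC.
rewrite sumrMnl; case: eqP => [e|/eqP e] /=.
  rewrite e modnn big_pred0// -S mulr1n; apply/esym/eqP; rewrite subr_eq0.
  by apply/eqP/eq_bigl => j; rewrite e ltn_ord.
have -> : ((i.+1 %% n) = i.+1)%N.
  by rewrite modn_small// ltn_neqAle e ltn_ord.
by rewrite mulr0n subr0.
Qed.

(** * Differentiation rules and a Gronwall inequality *)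

Lemma is_derive_addf (R : realType) (f g : R -> R) (t df dg : R) :
  is_derive t 1 f df -> is_derive t 1 g dg ->
  is_derive t (1 : R) (fun u => f u + g u) (df + dg).
Proof. by move=> ? ?; apply: is_deriveD. Qed.

Lemma is_derive_subf (R : realType) (f g : R -> R) (t df dg : R) :
  is_derive t 1 f df -> is_derive t 1 g dg ->
  is_derive t (1 : R) (fun u => f u - g u) (df - dg).
Proof. by move=> ? ?; apply: is_deriveB. Qed.

Lemma is_derive_mulf (R : realType) (f g : R -> R) (t df dg : R) :
  is_derive t 1 f df -> is_derive t 1 g dg ->
  is_derive t (1 : R) (fun u => f u * g u) (f t * dg + g t * df).
Proof. by move=> ? ?; apply: is_deriveM. Qed.

Lemma is_derive_constf (R : realType) (c t : R) :
  is_derive t (1 : R) (fun _ : R => c) 0.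
Proof. exact: is_derive_cst. Qed.

Lemma is_derive_cosf (R : realType) (f : R -> R) (t df : R) :
  is_derive t 1 f df ->
  is_derive t (1 : R) (fun u => cos (f u)) (- sin (f t) * df).
Proof. by move=> ?; apply: is_derive1_comp. Qed.

Lemma is_derive_sinf (R : realType) (f : R -> R) (t df : R) :
  is_derive t 1 f df ->
  is_derive t (1 : R) (fun u => sin (f u)) (cos (f t) * df).
Proof. by move=> ?; apply: is_derive1_comp. Qed.

Lemma is_derive_sumf (R : realType) (n : nat) (h : 'I_n -> R -> R) (t : R)
    (dh : 'I_n -> R) : (forall i, is_derive t 1 (h i) (dh i)) ->
  is_derive t (1 : R) (fun u => \sum_(i < n) h i u) (\sum_(i < n) dh i).
Proof.
move=> dhi; rewrite (_ : (fun u => _) = \sum_(i < n) h i).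
  exact: is_derive_sum.
by apply/funext => u; rewrite fct_sumE.
Qed.

Lemma is_derive_continuous (R : realType) (f : R -> R) (t df : R) :
  is_derive t 1 f df -> {for t, continuous f}.
Proof.
by move=> d; apply/differentiable_continuous/derivable1_diffP/(@ex_derive _ _ _ _ _ _ _ d).
Qed.

Lemma continuous_within_itv (R : realType) (f : R -> R) (T : R) :
  (forall t : R, 0 <= t -> {for t, continuous f}) ->
  {within `[0, T], continuous f}.
Proof.
move=> fc; apply: continuous_in_subspaceT => t; rewrite inE/= in_itv/=.
by case/andP => t0 _; exact: fc.
Qed.

Lemma derive0_constant (R : realType) (f : R -> R) :
  (forall t : R, 0 <= t -> is_derive t 1 f 0) -> forall t, 0 <= t -> f t = f 0.
Proof.
move=> df t t0; apply/eqP; rewrite -subr_eq0; apply/eqP.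
have [||c _ ->] := @MVT_segment R f (fun=> 0) 0 t t0; last by rewrite mul0r.
- by move=> x; rewrite in_itv/= => /andP[/ltW x0 _]; exact: df.
- by apply: continuous_within_itv => x /df/is_derive_continuous.
Qed.

(** Let [K c] be the maximum of [K] on [[0, T]]. Then [E t * expR (- (K c * t))] starts at 0 and has
    nonpositive derivative on [[0, T]], so [E T <= 0]. *)
Lemma gronwall_eq0 (R : realType) (E dE K : R -> R) :
  (forall t : R, 0 <= t -> is_derive t 1 E (dE t)) ->
  (forall t : R, 0 <= t -> {for t, continuous K}) ->
  (forall t, 0 <= E t) ->
  (forall t : R, 0 <= t -> dE t <= K t * E t) ->
  E 0 = 0 -> forall t : R, 0 <= t -> E t = 0.
Proof.
move=> hE hK E0 hdE E00 T T0.
have [c _ Kc] := EVT_max T0 (@continuous_within_itv _ _ T hK).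
pose F t := E t * expR (- (K c * t)).
have dF (t : R) : 0 <= t ->
    is_derive t 1 F ((dE t - K c * E t) * expR (- (K c * t))).
  move=> t0; have dEt := hE t t0.
  have d1 : is_derive t 1 (fun u : R => - (K c * u)) (- K c).
    have := is_derive_mulf (is_derive_constf (- K c) t) (is_derive_id t 1).
    rewrite mulr0 addr0 mulr1 => d; rewrite (_ : (fun u => _) =
      (fun u => - K c * u))//; apply/funext => u; exact/esym/mulNr.
  have d2 : is_derive t 1 (fun u => expR (- (K c * u)))
      (expR (- (K c * t)) * (- K c)) by apply: is_derive1_comp.
  by apply: is_derive_eq (is_derive_mulf dEt d2) _; ring.
apply/eqP; rewrite eq_le E0 andbT -(pmulr_lle0 _ (expR_gt0 (- (K c * T)))).
rewrite -/(F T) (_ : F T = F T - F 0); last by rewrite /F E00 mul0r subr0.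
have [x||z zT ->] := @MVT_segment R F (fun t => (dE t - K c * E t) * expR (- (K c * t))) 0 T T0.
- by rewrite in_itv/= => /andP[/ltW x0 _]; exact: dF.
- by apply: continuous_within_itv => x /dF/is_derive_continuous.
have z0 : 0 <= z by move: zT; rewrite in_itv/= => /andP[].
rewrite subr0; apply: mulr_le0_ge0 => //; apply: mulr_le0_ge0; last first.
  exact: expR_ge0.
by rewrite subr_le0 (le_trans (hdE z z0))// ler_wpM2r// Kc.
Qed.

(** * Coordinates in the frame of a vehicle *)

(** Component along the heading of the vector to the pursued vehicle; [lft] is its component to the
    left. These are a and b of the overview. *)
Definition fwd (R : realType) (n : nat) (c : config R n) (i : 'I_n) : R :=
  (xpos c (ordS i) - xpos c i) * cos (heading c i)
  + (ypos c (ordS i) - ypos c i) * sin (heading c i).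

Definition lft (R : realType) (n : nat) (c : config R n) (i : 'I_n) : R :=
  (ypos c (ordS i) - ypos c i) * cos (heading c i)
  - (xpos c (ordS i) - xpos c i) * sin (heading c i).

Definition dheading (R : realType) (n : nat) (c : config R n) (i : 'I_n) : R :=
  heading c (ordS i) - heading c i.

(** Rotating by the heading turns world components into frame components, and [dheading] is
    [- beta - pi] modulo [2 * pi], whence the signs. The distance equation is recovered from the two
    components and [0 < rho]. *)
Lemma relcoordsP (R : realType) (n : nat) (c : config R n) (xi : 'M[R]_(n, 3)) :
  relcoords c xi <-> forall i : 'I_n,
    [/\ 0 < rho xi i,
        fwd c i = rho xi i * cos (alpha xi i),
        lft c i = rho xi i * sin (alpha xi i),
        cos (dheading c i) = - cos (beta xi i)
      & sin (dheading c i) = sin (beta xi i)].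
Proof.
have ang (x y b : R) : eqmod2pi b (x - y - pi) <->
    cos (y - x) = - cos b /\ sin (y - x) = sin b.
  rewrite eqmod2piP -(opprB y x) cosB sinB cospi sinpi cosN sinN.
  by split=> -[h1 h2]; split; lra.
split=> H i; have := H i; rewrite /fwd /lft /dheading.
  have e := cos2Dsin2 (heading c i).
  move=> [r0 _ -> -> /ang[-> ->]]; split=> //; rewrite cosD sinD.
    (* A factor 1 is replaced by cos^2 + sin^2 of the heading, which makes the identity
       polynomial. *)
    by rewrite -[RHS]mulr1 -e; ring.
  by rewrite -[RHS]mulr1 -e; ring.
move=> [r0 hf hl hc hs].
have e := cos2Dsin2 (heading c i).
have dx : xpos c (ordS i) - xpos c i =
    rho xi i * cos (heading c i + alpha xi i).
  by rewrite cosD mulrBr ![rho _ _ * (_ * _)]mulrCA -hf -hl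
    -[LHS]mulr1 -e; ring.
have dy : ypos c (ordS i) - ypos c i =
    rho xi i * sin (heading c i + alpha xi i).
  by rewrite sinD mulrDr ![rho _ _ * (_ * _)]mulrCA -hf -hl
    -[LHS]mulr1 -e; ring.
split=> //; last by apply/ang.
by rewrite dx dy !exprMn -mulrDr cos2Dsin2 mulr1 sqrtr_sqr gtr0_norm.
Qed.

Definition turn_rate (R : realType) (v k a b P Q : R) : R :=
  (2 * v * b + k * (a * (1 - P) - b * Q)) / (a ^+ 2 + b ^+ 2).

(** The right-hand side depends on [c] alone, so all relative coordinates of [c] give the same
    turning rate. *)
Lemma omega_turn_rate (R : realType) (n : nat) (v k : R) (c : config R n)
    (xi : 'M[R]_(n, 3)) (i : 'I_n) :
  relcoords c xi -> omega v k xi i =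
  turn_rate v k (fwd c i) (lft c i) (cos (dheading c i)) (sin (dheading c i)).
Proof.
move=> /relcoordsP/(_ i)[r0 -> -> -> ->]; rewrite /turn_rate /omega cosD.
rewrite !exprMn -mulrDr cos2Dsin2 mulr1.
by field; rewrite gt_eqF.
Qed.

Lemma relcoords_gt0 (R : realType) (n : nat) (c : config R n)
    (xi : 'M[R]_(n, 3)) (i : 'I_n) :
  relcoords c xi -> 0 < fwd c i ^+ 2 + lft c i ^+ 2.
Proof.
move=> /relcoordsP/(_ i)[r0 -> -> _ _].
by rewrite !exprMn -mulrDr cos2Dsin2 mulr1 exprn_gt0.
Qed.

(** * Determination of the equilibria *)

(** The congruence says that [a + b] is the supplement of [a]; the two equations are those appearing
    in [fhat]. *)
Lemma cos_supplementary (R : realType) (a b : R) :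
  eqmod2pi (2 * a + b) pi <->
  cos (a + b) = - cos a /\ sin (a + b) = sin a.
Proof.
rewrite (_ : eqmod2pi _ _ <-> eqmod2pi (a + b) (pi - a)).
  by rewrite eqmod2piP cosB sinB cospi sinpi; split=> -[h1 h2]; split; lra.
by split=> -[m e]; exists m; lra.
Qed.

Lemma equilibriaE (R : realType) (n : nat) (v k : R) :
  (0 < n)%N -> 0 < v -> @equilibria R n v k = @Xi R n.
Proof.
move=> n0 v0; apply/seteqP; split=> xi.
  move=> [hM hf].
  have ent i (j : 'I_3) := congr1 (fun A : 'M[R]_(n, 3) => A i j) hf.
  have h2 i : eqmod2pi (2 * alpha xi i + beta xi i) pi.
    have r0 : 0 < rho xi i by case: hM.
    have := ent i 0; rewrite !mxE/= => /eqP; rewrite mulf_eq0 oppr_eq0 gt_eqF//=.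
    rewrite addrC => /eqP h0.
    have := ent i 1; rewrite !mxE/= [cos _ + _]addrC h0 mulr0 subr0 => /eqP.
    rewrite mulf_eq0 gt_eqF ?divr_gt0//= subr_eq0 => /eqP h1.
    apply/cos_supplementary; split=> //; apply/eqP; rewrite -addr_eq0; exact/eqP.
  (* The value at vehicle 0 serves as [s]; the [beta] component of [fhat] equates it between
     successive vehicles. *)
  split=> //; exists (sin (alpha xi (Ordinal n0)) / rho xi (Ordinal n0)) => i.
  apply: (ordS_invariant (f := fun j => sin (alpha xi j) / rho xi j)) => {}i.
  have := ent i 2%:R; rewrite !mxE/= /omega.
  have [/cos_supplementary[-> _] /cos_supplementary[-> _]] := (h2 i, h2 (ordS i)).
  rewrite !subrr !mulr0 !addr0 => /eqP; rewrite subr_eq0 => /eqP e.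
  have v2 : 2 * v != 0 by rewrite mulf_neq0// gt_eqF.
  by apply: (mulfI v2); rewrite !(mulrCA (2 * v)) !(mulrC _ (2 * v / _)).
move=> [hM h2 [s hs]]; split=> //; apply/matrixP => i j; rewrite !mxE /omega.
have [/cos_supplementary[-> ->] /cos_supplementary[-> _]] := (h2 i, h2 (ordS i)).
rewrite !subrr !mulr0 !addr0.
have {}hs l : 2 * v / rho xi l * sin (alpha xi l) = 2 * v * s.
  by rewrite mulrAC -mulrA hs.
by rewrite !hs subr0 subrr; case: j => [[|[|[|]]]].
Qed.

(** * Estimates on the deviation from an equilibrium *)

(** Lagrange's identity: the difference is the sum of the six squared minors. *)
Lemma cauchy_schwarz4 (R : realFieldType) (c1 c2 c3 c4 x1 x2 x3 x4 : R) :
  (c1 * x1 + c2 * x2 + c3 * x3 + c4 * x4) ^+ 2 <=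
  (c1 ^+ 2 + c2 ^+ 2 + c3 ^+ 2 + c4 ^+ 2) *
  (x1 ^+ 2 + x2 ^+ 2 + x3 ^+ 2 + x4 ^+ 2).
Proof.
rewrite -subr_ge0 (_ : _ - _ =
  (c1 * x2 - c2 * x1) ^+ 2 + (c1 * x3 - c3 * x1) ^+ 2 +
  (c1 * x4 - c4 * x1) ^+ 2 + (c2 * x3 - c3 * x2) ^+ 2 +
  (c2 * x4 - c4 * x2) ^+ 2 + (c3 * x4 - c4 * x3) ^+ 2); last by ring.
by rewrite !addr_ge0// sqr_ge0.
Qed.

(* Sum of the squared coefficients of (turn_rate - w) (a^2 + b^2) written as a
   linear form in the errors a - a0, b - b0, P - P0, Q - Q0. *)
Definition turn_rate_gain (R : realType) (v k w a0 b0 a b P Q : R) : R :=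
  ((k * (1 - P) - w * (a + a0)) ^+ 2 + (2 * v - k * Q - w * (b + b0)) ^+ 2
   + (k * a0) ^+ 2 + (k * b0) ^+ 2) / (a ^+ 2 + b ^+ 2) ^+ 2.

Definition sqdist4 (R : realType) (a0 b0 P0 Q0 a b P Q : R) : R :=
  (a - a0) ^+ 2 + (b - b0) ^+ 2 + (P - P0) ^+ 2 + (Q - Q0) ^+ 2.

Lemma turn_rate_gain_ge0 (R : realType) (v k w a0 b0 a b P Q : R) :
  0 <= turn_rate_gain v k w a0 b0 a b P Q.
Proof. by rewrite divr_ge0 ?sqr_ge0// !addr_ge0// sqr_ge0. Qed.

(** The first hypothesis states, cleared of denominators, that the turning rate at the reference
    point is [w]. Subtracting it leaves a linear form in the errors, to which Cauchy-Schwarz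
    applies. *)
Lemma turn_rate_lipschitz (R : realType) (v k w a0 b0 P0 Q0 a b P Q : R) :
  2 * v * b0 + k * (a0 * (1 - P0) - b0 * Q0) = w * (a0 ^+ 2 + b0 ^+ 2) ->
  0 < a ^+ 2 + b ^+ 2 ->
  (turn_rate v k a b P Q - w) ^+ 2 <=
  turn_rate_gain v k w a0 b0 a b P Q * sqdist4 a0 b0 P0 Q0 a b P Q.
Proof.
move=> e r0; set r := a ^+ 2 + b ^+ 2 in r0 *.
have -> : turn_rate v k a b P Q - w =
    ((k * (1 - P) - w * (a + a0)) * (a - a0)
     + (2 * v - k * Q - w * (b + b0)) * (b - b0)
     + (- (k * a0)) * (P - P0) + (- (k * b0)) * (Q - Q0)) / r.
  apply: (mulIf (lt0r_neq0 r0)); rewrite divfK ?gt_eqF// mulrBl.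
  rewrite /turn_rate -/r divfK ?gt_eqF// -[LHS]addr0 -(subrr (w * (a0 ^+ 2 + b0 ^+ 2))).
  by rewrite -{2}e /r; ring.
rewrite expr_div_n /turn_rate_gain -/r /sqdist4 [leRHS]mulrAC ler_pM2r; last first.
  by rewrite invr_gt0 exprn_gt0.
apply: le_trans (cauchy_schwarz4 _ _ _ _ _ _ _ _) _.
by rewrite !sqrrN.
Qed.

(* The left-hand side is the derivative of sqdist4 along the flow. The turning
   rate o acts on (a, b) as an infinitesimal rotation, so it enters only through
   (o - w) (b0 (a - a0) - a0 (b - b0)), whose second factor does not involve a^2
   or b^2. *)
Lemma sqdist4_rate_le (R : realType)
    (v w a0 b0 P0 Q0 a b P Q o o' K K' e' E : R) :
  0 <= v -> v * (P0 - 1) + w * b0 = 0 -> v * Q0 - w * a0 = 0 ->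
  P0 ^+ 2 + Q0 ^+ 2 = 1 -> 0 <= K -> 0 <= K' ->
  (o - w) ^+ 2 <= K * sqdist4 a0 b0 P0 Q0 a b P Q ->
  (o' - w) ^+ 2 <= K' * e' ->
  sqdist4 a0 b0 P0 Q0 a b P Q <= E -> e' <= E ->
  2 * ((a - a0) * (v * (P - 1) + o * b) + (b - b0) * (v * Q - o * a)
       + (P - P0) * (- Q * (o' - o)) + (Q - Q0) * (P * (o' - o)))
  <= (v + (a0 ^+ 2 + b0 ^+ 2) + 2 + 2 * K + K') * E.
Proof.
move=> v0 h1 h2 h3 K0 K'0 ho ho' he he'.
set e := sqdist4 _ _ _ _ _ _ _ _ in ho he.
pose A := a - a0; pose B := b - b0; pose p := P - P0; pose q := Q - Q0.
(* [Z] is the coefficient of [o' - o]: in [q * P - p * Q] the products [p * q] cancel. *)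
pose Z := q * P0 - p * Q0; pose X := o - w; pose X' := o' - w.
have Z2 : Z ^+ 2 <= p ^+ 2 + q ^+ 2.
  have := sqr_ge0 (p * P0 + q * Q0).
  have : (p ^+ 2 + q ^+ 2) * (P0 ^+ 2 + Q0 ^+ 2) = p ^+ 2 + q ^+ 2.
    by rewrite h3 mulr1.
  rewrite /Z => i1 i2; rewrite -i1 -subr_ge0 (_ : _ - _ = (p * P0 + q * Q0) ^+ 2) //.
  by ring.
have W2 : (b0 * A - a0 * B) ^+ 2 <= (a0 ^+ 2 + b0 ^+ 2) * (A ^+ 2 + B ^+ 2).
  rewrite -subr_ge0 (_ : _ - _ = (a0 * A + b0 * B) ^+ 2) ?sqr_ge0//.
  by ring.
have pq0 : 0 <= p ^+ 2 + q ^+ 2 by rewrite addr_ge0 ?sqr_ge0.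
have AB0 : 0 <= A ^+ 2 + B ^+ 2 by rewrite addr_ge0 ?sqr_ge0.
have eE : e = (A ^+ 2 + B ^+ 2) + (p ^+ 2 + q ^+ 2) by rewrite /e /sqdist4 -addrA.
have r0 : 0 <= a0 ^+ 2 + b0 ^+ 2 by rewrite addr_ge0 ?sqr_ge0.
have W3 : (b0 * A - a0 * B) ^+ 2 <= (a0 ^+ 2 + b0 ^+ 2) * E.
  by apply: (le_trans W2); apply: ler_wpM2l => //; lra.
have X2 : X ^+ 2 <= K * E by apply: (le_trans ho); exact: ler_wpM2l.
have X2' : X' ^+ 2 <= K' * E by apply: (le_trans ho'); exact: ler_wpM2l.
have V : v * (2 * (A * p + B * q)) <= v * E.
  apply: ler_wpM2l => //; apply: le_trans he.
  have := sqr_ge0 (A - p); have := sqr_ge0 (B - q).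
  by rewrite eE !sqrrB; lra.
have -> : 2 * ((a - a0) * (v * (P - 1) + o * b) + (b - b0) * (v * Q - o * a)
       + (P - P0) * (- Q * (o' - o)) + (Q - Q0) * (P * (o' - o))) =
   v * (2 * (A * p + B * q)) + 2 * (X * (b0 * A - a0 * B))
   + 2 * (Z * X') - 2 * (Z * X).
  (* Multiples of [h1] and [h2] are subtracted, so only differences from the stationary point
     remain. *)
  rewrite -[LHS]addr0 -(mulr0 (- (2 * A))) -h1.
  rewrite -[LHS]addr0 -(mulr0 (- (2 * B))) -h2.
  rewrite /Z /X /X' /A /B /p /q.
  by ring.
have Z2E : Z ^+ 2 <= E.
  by apply: (le_trans Z2); apply: le_trans he; rewrite eE lerDr.
have -> : (v + (a0 ^+ 2 + b0 ^+ 2) + 2 + 2 * K + K') * E =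
    v * E + (a0 ^+ 2 + b0 ^+ 2) * E + 2 * E + 2 * (K * E) + K' * E by ring.
move: (b0 * A - a0 * B) (v * (2 * _)) (v * E) ((a0 ^+ 2 + b0 ^+ 2) * E)
  (K * E) (K' * E) W3 V X2 X2' => U Y vE rE KE KE' hU hY hX hX'.
(* These squares bound the three cross products. [Z ^+ 2] and [X ^+ 2] each occur twice, which
   yields the coefficients [2] and [2 * K]. *)
have := sqr_ge0 (X - U); have := sqr_ge0 (Z - X'); have := sqr_ge0 (Z + X).
clearbody X X' Z; clear Z2 W2.
clear -hU hY hX hX' Z2E.
by rewrite !(sqrrB, sqrrD); lra.
Qed.

Lemma sqdist4_ge0 (R : realType) (a0 b0 P0 Q0 a b P Q : R) :
  0 <= sqdist4 a0 b0 P0 Q0 a b P Q.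
Proof. by rewrite !addr_ge0// sqr_ge0. Qed.

Lemma sqdist4_eq0 (R : realType) (a0 b0 P0 Q0 a b P Q : R) :
  sqdist4 a0 b0 P0 Q0 a b P Q = 0 -> [/\ a = a0, b = b0, P = P0 & Q = Q0].
Proof.
have n0 := @sqr_ge0 R; move=> /eqP; rewrite /sqdist4 !paddr_eq0 ?addr_ge0//.
rewrite !sqrf_eq0 !subr_eq0 -!andbA => /and4P[/eqP ? /eqP ? /eqP ? /eqP ?].
by split.
Qed.

(** * Derivatives along a motion *)

Lemma is_derive_sqrf (R : realType) (f : R -> R) (t df : R) :
  is_derive t 1 f df ->
  is_derive t (1 : R) (fun u => f u ^+ 2) (2 * (f t * df)).
Proof. by move=> d; apply: is_derive_eq (is_derive_mulf d d) _; ring. Qed.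

Lemma is_derive_sqr_sub (R : realType) (f : R -> R) (f0 t df : R) :
  is_derive t 1 f df ->
  is_derive t (1 : R) (fun u => (f u - f0) ^+ 2) (2 * ((f t - f0) * df)).
Proof.
move=> d; have := is_derive_sqrf (is_derive_subf d (is_derive_constf f0 t)).
by rewrite subr0.
Qed.

Lemma is_derive_sqdist4 (R : realType) (a b P Q : R -> R)
    (a0 b0 P0 Q0 t da db dP dQ : R) :
  is_derive t 1 a da -> is_derive t 1 b db ->
  is_derive t 1 P dP -> is_derive t 1 Q dQ ->
  is_derive t (1 : R) (fun u => sqdist4 a0 b0 P0 Q0 (a u) (b u) (P u) (Q u))
    (2 * ((a t - a0) * da + (b t - b0) * db + (P t - P0) * dP
          + (Q t - Q0) * dQ)).
Proof.
move=> ha hb hP hQ; rewrite !mulrDr.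
by do !apply: is_derive_addf; apply: is_derive_sqr_sub.
Qed.

(** Supplies the continuity of the Gronwall coefficient: numerator and denominator are
    differentiable, and the denominator is nonzero without overlap. *)
Lemma turn_rate_gain_continuous (R : realType) (v k w a0 b0 t da db dP dQ : R)
    (a b P Q : R -> R) :
  is_derive t 1 a da -> is_derive t 1 b db ->
  is_derive t 1 P dP -> is_derive t 1 Q dQ ->
  0 < a t ^+ 2 + b t ^+ 2 ->
  {for t, continuous (fun u => turn_rate_gain v k w a0 b0 (a u) (b u) (P u) (Q u))}.
Proof.
move=> ha hb hP hQ r0.
have cst (c : R) := is_derive_constf c t.
have hN1 := is_derive_sqrf (is_derive_subf
  (is_derive_mulf (cst k) (is_derive_subf (cst 1) hP))
  (is_derive_mulf (cst w) (is_derive_addf ha (cst a0)))).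
have hN2 := is_derive_sqrf (is_derive_subf
  (is_derive_subf (cst (2 * v)) (is_derive_mulf (cst k) hQ))
  (is_derive_mulf (cst w) (is_derive_addf hb (cst b0)))).
have hN := is_derive_addf (is_derive_addf (is_derive_addf hN1 hN2)
  (is_derive_sqrf (cst (k * a0)))) (is_derive_sqrf (cst (k * b0))).
have hD := is_derive_sqrf (is_derive_addf (is_derive_sqrf ha)
  (is_derive_sqrf hb)).
have D0 : (a t ^+ 2 + b t ^+ 2) ^+ 2 != 0 by rewrite expf_neq0// gt_eqF.
have cD := @continuousV _ _ (fun u => (a u ^+ 2 + b u ^+ 2) ^+ 2) t D0
  (is_derive_continuous hD).
exact: continuousM (is_derive_continuous hN) cD.
Qed.

Lemma continuous_affine2 (R : realType) (c d t : R) (f g : R -> R) :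
  {for t, continuous f} -> {for t, continuous g} ->
  {for t, continuous (fun u => c + d * f u + g u)}.
Proof.
move=> cf cg.
have c1 := @continuousM _ _ (fun=> d) f t (@cst_continuous _ _ _ _) cf.
exact: continuousD (continuousD (@cst_continuous _ _ c t) c1) cg.
Qed.

(** In the frame of vehicle [i] the relative velocity is [v] times (cos d - 1, sin d), d being
    [dheading]; the rotation of the frame adds the terms in [o i]. *)
Lemma frame_derive (R : realType) (n : nat) (v k : R) (q : R -> config R n)
    (t : R) (i : 'I_n) :
  closed_loop v k q -> 0 <= t ->
  let o j := turn_rate v k (fwd (q t) j) (lft (q t) j)
               (cos (dheading (q t) j)) (sin (dheading (q t) j)) in
  [/\ is_derive t 1 (fun u : R => fwd (q u) i)
        (v * (cos (dheading (q t) i) - 1) + o i * lft (q t) i),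
      is_derive t 1 (fun u : R => lft (q u) i)
        (v * sin (dheading (q t) i) - o i * fwd (q t) i),
      is_derive t 1 (fun u : R => cos (dheading (q u) i))
        (- sin (dheading (q t) i) * (o (ordS i) - o i))
    & is_derive t 1 (fun u : R => sin (dheading (q u) i))
        (cos (dheading (q t) i) * (o (ordS i) - o i))].
Proof.
move=> cl t0 o; have [xi rc H] := cl t t0.
have e := cos2Dsin2 (heading (q t) i).
have {}H j : [/\ is_derive t 1 (fun u : R => xpos (q u) j)
          (v * cos (heading (q t) j)),
        is_derive t 1 (fun u : R => ypos (q u) j)
          (v * sin (heading (q t) j))
      & is_derive t 1 (fun u : R => heading (q u) j) (o j)].
  by have [? ?] := H j; rewrite (omega_turn_rate _ _ _ rc).
have [[hx hy hh] [hx' hy' hh']] := (H i, H (ordS i)).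
have dx := is_derive_subf hx' hx.
have dy := is_derive_subf hy' hy.
have dh := is_derive_subf hh' hh.
have dc := is_derive_cosf hh.
have ds := is_derive_sinf hh.
split.
- apply: is_derive_eq (is_derive_addf (is_derive_mulf dx dc)
    (is_derive_mulf dy ds)) _.
  rewrite /lft /dheading cosB -[in RHS]e; ring.
- apply: is_derive_eq (is_derive_subf (is_derive_mulf dy dc)
    (is_derive_mulf dx ds)) _.
  rewrite /fwd /dheading sinB; ring.
- exact: is_derive_cosf.
- exact: is_derive_sinf.
Qed.

(** * Invariance of the relative coordinates *)

Lemma relcoords_invariant (R : realType) (n : nat) (v k s : R)
    (xi : 'M[R]_(n, 3)) (q : R -> config R n) :
  0 < v -> Xi xi -> (forall i : 'I_n, sin (alpha xi i) / rho xi i = s) ->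
  closed_loop v k q -> relcoords (q 0) xi ->
  forall t : R, 0 <= t -> relcoords (q t) xi.
Proof.
move=> v0 [[r0 _ _ _] hab _] hs cl rc0.
pose w := 2 * v * s.
(* Reference values: what [relcoordsP] prescribes for a configuration with coordinates [xi]. *)
pose a0 i := rho xi i * cos (alpha xi i).
pose b0 i := rho xi i * sin (alpha xi i).
pose P0 i := - cos (beta xi i).
pose Q0 i := sin (beta xi i).
pose er i t := sqdist4 (a0 i) (b0 i) (P0 i) (Q0 i) (fwd (q t) i) (lft (q t) i)
  (cos (dheading (q t) i)) (sin (dheading (q t) i)).
pose E t := \sum_(i < n) er i t.
have sinE i : sin (alpha xi i) = s * rho xi i by rewrite -(hs i) divfK ?gt_eqF.
(* At the equilibrium [beta] is [pi - 2 * alpha], so these are the cosine and sine of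
   [2 * alpha]. *)
have cb i : P0 i = 1 - 2 * sin (alpha xi i) ^+ 2 /\
            Q0 i = 2 * (sin (alpha xi i) * cos (alpha xi i)).
  have /cos_supplementary[c1 c2] := hab i.
  rewrite /P0 /Q0 -[beta xi i](addrK (alpha xi i)) (addrC (beta _ _)).
  rewrite cosB sinB c1 c2; split; last by ring.
  by rewrite -{1}(cos2Dsin2 (alpha xi i)); ring.
have a0b0 i : a0 i ^+ 2 + b0 i ^+ 2 = rho xi i ^+ 2.
  by rewrite !exprMn -mulrDr cos2Dsin2 mulr1.
(* [eq1], [eq2] and [eq4] express that the reference point is stationary and turns at rate [w]. *)
have eq1 i : v * (P0 i - 1) + w * b0 i = 0.
  by rewrite (cb i).1 /b0 /w sinE; ring.
have eq2 i : v * Q0 i - w * a0 i = 0.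
  by rewrite (cb i).2 /a0 /w sinE; ring.
have eq3 i : P0 i ^+ 2 + Q0 i ^+ 2 = 1 by rewrite sqrrN cos2Dsin2.
have eq4 i : 2 * v * b0 i + k * (a0 i * (1 - P0 i) - b0 i * Q0 i) =
    w * (a0 i ^+ 2 + b0 i ^+ 2).
  by rewrite a0b0 (cb i).1 (cb i).2 /a0 /b0 /w sinE; ring.
pose o i t := turn_rate v k (fwd (q t) i) (lft (q t) i)
  (cos (dheading (q t) i)) (sin (dheading (q t) i)).
pose G i t := turn_rate_gain v k w (a0 i) (b0 i) (fwd (q t) i) (lft (q t) i)
  (cos (dheading (q t) i)) (sin (dheading (q t) i)).
pose dE t := \sum_(i < n) (2 *
  ((fwd (q t) i - a0 i) *
     (v * (cos (dheading (q t) i) - 1) + o i t * lft (q t) i)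
   + (lft (q t) i - b0 i) *
     (v * sin (dheading (q t) i) - o i t * fwd (q t) i)
   + (cos (dheading (q t) i) - P0 i) *
     (- sin (dheading (q t) i) * (o (ordS i) t - o i t))
   + (sin (dheading (q t) i) - Q0 i) *
     (cos (dheading (q t) i) * (o (ordS i) t - o i t)))).
pose K t := \sum_(i < n)
  (v + (a0 i ^+ 2 + b0 i ^+ 2) + 2 + 2 * G i t + G (ordS i) t).
have rpos i (t : R) : 0 <= t -> 0 < fwd (q t) i ^+ 2 + lft (q t) i ^+ 2.
  by move=> /cl[xi' rc _]; exact: relcoords_gt0 rc.
have er0 i t : 0 <= er i t by exact: sqdist4_ge0.
have erE i t : er i t <= E t.
  by rewrite /E (bigD1 i)//= lerDl sumr_ge0.
have Ge0 i t : 0 <= G i t by exact: turn_rate_gain_ge0.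
have Gcont i (t : R) : 0 <= t -> {for t, continuous (G i)}.
  move=> t0; have [da db dP dQ] := frame_derive i cl t0.
  exact: (turn_rate_gain_continuous da db dP dQ (rpos i t t0)).
have E00 : forall t : R, 0 <= t -> E t = 0.
  apply: (gronwall_eq0 (dE := dE) (K := K)).
  - move=> t t0; apply: is_derive_sumf => i.
    have [da db dP dQ] := frame_derive i cl t0.
    exact: is_derive_sqdist4 da db dP dQ.
  - move=> t t0; rewrite /K; apply: cvg_big; first exact: add_continuous.
    by move=> i _; apply: continuous_affine2; exact: Gcont.
  - by move=> t; apply: sumr_ge0.
  - move=> t t0; rewrite /K mulr_suml; apply: ler_sum => i _.
    (* The turning rate of the pursued vehicle brings in the error of [ordS i]; both errors are
       bounded by the total [E], which closes the estimate. *)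
    apply: (@sqdist4_rate_le _ v w _ _ _ _ _ _ _ _ _ _ _ _ (er (ordS i) t)) => //.
    + exact: ltW.
    + exact: turn_rate_lipschitz (eq4 i) (rpos i t t0).
    + exact: turn_rate_lipschitz (eq4 (ordS i)) (rpos (ordS i) t t0).
    + exact: (erE i t).
  - apply: big1 => i _; have /relcoordsP/(_ i)[_ h1 h2 h3 h4] := rc0.
    by rewrite /er h1 h2 h3 h4 /sqdist4 !subrr expr0n !addr0.
move=> t t0; apply/relcoordsP => i.
have : er i t = 0 by apply/eqP; rewrite eq_le er0 andbT; have := erE i t; rewrite E00.
by move=> /sqdist4_eq0[].
Qed.

(** * Headings and chords at an equilibrium *)

Lemma omega_Xi (R : realType) (n : nat) (v k s : R) (xi : 'M[R]_(n, 3))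
    (i : 'I_n) :
  Xi xi -> sin (alpha xi i) / rho xi i = s -> omega v k xi i = 2 * v * s.
Proof.
move=> [_ /(_ i)/cos_supplementary[c _] _] <-.
by rewrite /omega c subrr mulr0 addr0 mulrAC mulrA.
Qed.

Lemma heading_derive (R : realType) (n : nat) (v k s : R)
    (xi : 'M[R]_(n, 3)) (q : R -> config R n) (t : R) (i : 'I_n) :
  Xi xi -> sin (alpha xi i) / rho xi i = s ->
  closed_loop v k q -> 0 <= t -> relcoords (q t) xi ->
  is_derive t 1 (fun u : R => heading (q u) i) (2 * v * s).
Proof.
move=> hX hs cl t0 rc; have [xi' rc' /(_ i)[_ _]] := cl t t0.
by rewrite (omega_turn_rate _ _ _ rc') -(omega_turn_rate _ _ _ rc) (omega_Xi _ _ hX hs).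
Qed.

Lemma heading_ordS (R : realType) (n : nat) (c : config R n)
    (xi : 'M[R]_(n, 3)) (i : 'I_n) :
  Xi xi -> relcoords c xi ->
  eqmod2pi (heading c (ordS i)) (heading c i + 2 * alpha xi i).
Proof.
move=> [_ /(_ i)[m2 e2] _] /(_ i)[_ _ _ _ [m1 e1]].
(* The [- 1] absorbs the two terms [pi] of the congruences. *)
by exists (m1 - m2 - 1); rewrite !intrD !mulrNz; lra.
Qed.

(** With [u] midway, the two angles are [u + alpha] and [u - alpha], and [sin alpha = s * rho] gives
    the sum-to-product formulas. For nonzero [s] the segment between the vehicles is a chord of a
    circle of radius [1 / (2 * |s|)]. The shift [phi] stands for a common rotation. *)
Lemma chord (R : realType) (n : nat) (c : config R n)
    (xi : 'M[R]_(n, 3)) (s phi : R) (i : 'I_n) :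
  Xi xi -> relcoords c xi -> sin (alpha xi i) / rho xi i = s ->
  sin (heading c (ordS i) + phi) - sin (heading c i + phi) =
    2 * s * (rho xi i * cos (heading c i + phi + alpha xi i)) /\
  cos (heading c (ordS i) + phi) - cos (heading c i + phi) =
    - (2 * s * (rho xi i * sin (heading c i + phi + alpha xi i))).
Proof.
move=> hX rc hs; have /eqmod2piP[e1 e2] := heading_ordS i hX rc.
have r0 : rho xi i != 0 by have [r0 _ _ _ _] := rc i; rewrite gt_eqF.
have hsin : s * rho xi i = sin (alpha xi i) by rewrite -hs divfK.
have [f1 f2] : cos (heading c (ordS i) + phi) =
      cos (heading c i + phi + alpha xi i + alpha xi i) /\
    sin (heading c (ordS i) + phi) =
      sin (heading c i + phi + alpha xi i + alpha xi i).
  rewrite cosD sinD e1 e2 -cosD -sinD; split; congr (_ _); lra.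
rewrite f1 f2 !mulrA -(mulrA 2 s) hsin.
set u := heading c i + phi + alpha xi i.
have -> : heading c i + phi = u - alpha xi i by rewrite /u addrK.
by rewrite cosB sinB cosD sinD; split; ring.
Qed.

(** * Existence of configurations and solutions *)

Lemma relcoords_intro (R : realType) (n : nat) (c : config R n)
    (xi : 'M[R]_(n, 3)) :
  (forall i : 'I_n,
    [/\ 0 < rho xi i,
        xpos c (ordS i) - xpos c i = rho xi i * cos (heading c i + alpha xi i),
        ypos c (ordS i) - ypos c i = rho xi i * sin (heading c i + alpha xi i)
      & eqmod2pi (beta xi i) (heading c i - heading c (ordS i) - pi)]) ->
  relcoords c xi.
Proof.
move=> H i; have [r0 dx dy hb] := H i; split=> //.
by rewrite dx dy !exprMn -mulrDr cos2Dsin2 mulr1 sqrtr_sqr gtr0_norm.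
Qed.

(** Vehicle 0 is put at the origin and vehicle [i] gets heading [gamma xi i]; positions are partial
    sums of the links. [g1] and [g2] close the polygon, [g3] closes the headings. *)
Lemma exists_config (R : realType) (n : nat) (xi : 'M[R]_(n, 3)) :
  manifoldM xi -> exists c : config R n, relcoords c xi.
Proof.
move=> [r0 hg1 hg2 [m hg3]].
pose X j := rho xi j * cos (gamma xi j + alpha xi j).
pose Y j := rho xi j * sin (gamma xi j + alpha xi j).
have X0 : \sum_(j < n) X j = 0.
  by rewrite -[RHS]hg2; apply: eq_bigr => j _; rewrite /X addrC.
have Y0 : \sum_(j < n) Y j = 0.
  by rewrite -[RHS]hg1; apply: eq_bigr => j _; rewrite /Y addrC.
exists (Config (fun i : 'I_n => \sum_(j < n | (j < i)%N) X j)
               (fun i : 'I_n => \sum_(j < n | (j < i)%N) Y j) (gamma xi)).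
apply: relcoords_intro => i; split=> //=.
- by rewrite sum_ltn_ordS sumrMnl X0 mul0rn subr0 addrC addKr.
- by rewrite sum_ltn_ordS sumrMnl Y0 mul0rn subr0 addrC addKr.
rewrite /gamma sum_ltn_ordS sumrMnl.
move: hg3; rewrite /g3 add0r; set S := \sum_(j < n) _; set Si := \sum_(j < n | _) _.
case: (eqVneq i.+1 n) => [e|ne] hg3.
  have -> : (ordS i : nat) = 0%N by rewrite /= e modnn.
  (* At the wrap the sum of all [beta] is [2 * m * pi - n * pi] by [g3]; elsewhere the multiple is
     1. *)
  exists (m - n%:Z + 1); rewrite !intrD !mulrNz mulr1n.
  have -> : i%:R = n%:R - 1 :> R by rewrite -[X in X%:R - 1]e -natr1 addrK.
  by rewrite -!pmulrn; lra.
have -> : (ordS i : nat) = i.+1.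
  by rewrite /= modn_small// ltn_neqAle ne ltn_ord.
by exists 1; rewrite mulr0n -natr1; lra.
Qed.

(** The solution is explicit: headings rotate at rate [w] and positions are integrated. It obeys the
    control law because its relative coordinates stay [xi]. *)
Lemma exists_closed_loop (R : realType) (n : nat) (v k s : R)
    (xi : 'M[R]_(n, 3)) :
  Xi xi -> (forall i : 'I_n, sin (alpha xi i) / rho xi i = s) ->
  exists q : R -> config R n, closed_loop v k q /\ relcoords (q 0) xi.
Proof.
move=> hX hs; have [hM _ _] := hX; have [c rc] := exists_config hM.
pose w := 2 * v * s.
(* The factor [(2 * s)^-1] satisfies [(2 * s)^-1 * w = v]; for [s = 0] the motion is straight. *)
pose dx i t := if s == 0 then v * cos (heading c i) * t
  else (2 * s)^-1 * (sin (heading c i + w * t) - sin (heading c i)).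
pose dy i t := if s == 0 then v * sin (heading c i) * t
  else (2 * s)^-1 * (cos (heading c i) - cos (heading c i + w * t)).
pose q t := Config (fun i => xpos c i + dx i t) (fun i => ypos c i + dy i t)
  (fun i => heading c i + w * t).
have rcq t : relcoords (q t) xi.
  apply: relcoords_intro => i /=; have [r0 _ hx hy hb] := rc i; split=> //.
  - rewrite (_ : _ - _ = rho xi i * cos (heading c i + alpha xi i)
        + (dx (ordS i) t - dx i t)); last by rewrite -hx; lra.
    (* The change of a link is the chord identity at [w * t] minus the one at 0. *)
    have [c1 c2] := chord (w * t) hX rc (hs i).
    have [d1 d2] := chord 0 hX rc (hs i).
    rewrite !addr0 in d1 d2.
    rewrite /dx; case: eqP => [s0|/eqP s0].
      rewrite /w s0 mulr0 mul0r addr0 -[RHS]addr0; congr (_ + _).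
      move: d2; rewrite s0 mulr0 mul0r oppr0 => /eqP; rewrite subr_eq0 => /eqP ->.
      by rewrite subrr.
    apply: (mulfI (mulf_neq0 (_ : 2 != 0) s0)); first by [].
    rewrite -c1 mulrDr -d1 mulrBr !mulVKf ?mulf_neq0//; lra.
  - rewrite (_ : _ - _ = rho xi i * sin (heading c i + alpha xi i)
        + (dy (ordS i) t - dy i t)); last by rewrite -hy; lra.
    have [c1 c2] := chord (w * t) hX rc (hs i).
    have [d1 d2] := chord 0 hX rc (hs i).
    rewrite !addr0 in d1 d2.
    rewrite /dy; case: eqP => [s0|/eqP s0].
      rewrite /w s0 mulr0 mul0r addr0 -[RHS]addr0; congr (_ + _).
      move: d1; rewrite s0 mulr0 mul0r => /eqP; rewrite subr_eq0 => /eqP ->.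
      by rewrite subrr.
    apply: (mulfI (mulf_neq0 (_ : 2 != 0) s0)); first by [].
    rewrite -[RHS]opprK -c2 mulrDr -[2 * s * (_ * _)]opprK -d2 mulrBr !mulVKf ?mulf_neq0//; lra.
  - by case: hb => m e; exists m; lra.
exists q; split=> // t t0; exists xi => // i /=.
rewrite (omega_Xi _ _ hX (hs i)) -/w.
have dwt := is_derive_mulf (is_derive_constf w t) (is_derive_id t 1).
have dh := is_derive_addf (is_derive_constf (heading c i) t) dwt.
have cst (a : R) := is_derive_constf a t.
split; last by apply: is_derive_eq dh _; ring.
- rewrite /dx; case: eqP => [s0|/eqP s0].
    apply: is_derive_eq (is_derive_addf (cst _)
      (is_derive_mulf (cst _) (is_derive_id t 1))) _.
    have -> : w = 0 by rewrite /w s0 mulr0.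
    by rewrite mul0r addr0; ring.
  apply: is_derive_eq (is_derive_addf (cst _) (is_derive_mulf (cst _)
    (is_derive_subf (is_derive_sinf dh) (cst _)))) _.
  by rewrite /w; field.
- rewrite /dy; case: eqP => [s0|/eqP s0].
    apply: is_derive_eq (is_derive_addf (cst _)
      (is_derive_mulf (cst _) (is_derive_id t 1))) _.
    have -> : w = 0 by rewrite /w s0 mulr0.
    by rewrite mul0r addr0; ring.
  apply: is_derive_eq (is_derive_addf (cst _) (is_derive_mulf (cst _)
    (is_derive_subf (cst _) (is_derive_cosf dh)))) _.
  by rewrite /w; field.
Qed.

(** * Circular and collinear formations *)

Lemma heading_linear (R : realType) (n : nat) (w : R) (q : R -> config R n)
    (i : 'I_n) :
  (forall t : R, 0 <= t -> is_derive t 1 (fun u : R => heading (q u) i) w) ->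
  forall t : R, 0 <= t -> heading (q t) i = heading (q 0) i + w * t.
Proof.
move=> H t t0.
have : heading (q t) i - w * t = heading (q 0) i - w * 0.
  move: t t0; apply: (derive0_constant (f := fun u => heading (q u) i - w * u)).
  move=> u /H d; apply: is_derive_eq (is_derive_subf d
    (is_derive_mulf (is_derive_constf w u) (is_derive_id u 1))) _.
  by ring.
by rewrite mulr0 subr0 => <-; rewrite subrK.
Qed.

(** The candidate centre ([cx], [cy]) of each vehicle lies at signed distance [(2 * s)^-1] to its
    left. It is constant in time by differentiation and common to all vehicles at time 0 by
    [chord]. *)
Lemma circular_of_heading (R : realType) (n : nat) (v k s : R)
    (xi : 'M[R]_(n, 3)) (q : R -> config R n) :
  (0 < n)%N -> 0 < v -> s != 0 -> Xi xi ->
  (forall i : 'I_n, sin (alpha xi i) / rho xi i = s) ->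
  closed_loop v k q -> relcoords (q 0) xi ->
  (forall (t : R) (i : 'I_n), 0 <= t ->
    is_derive t 1 (fun u : R => heading (q u) i) (2 * v * s)) ->
  circular_formation (2 * v * s) q.
Proof.
move=> n0 v0 s0 hX hs cl rc dh; split; first by rewrite !mulf_neq0 ?pnatr_eq0 ?(gt_eqF v0).
have s20 : 2 * s != 0 by rewrite mulf_neq0 ?pnatr_eq0.
pose cx t i := xpos (q t) i - (2 * s)^-1 * sin (heading (q t) i).
pose cy t i := ypos (q t) i + (2 * s)^-1 * cos (heading (q t) i).
have cx0 i j : cx 0 i = cx 0 j.
  apply: (ordS_invariant (f := cx 0)) => {}i; rewrite /cx.
  have [_ _ hx _ _] := rc i; have [] := chord 0 hX rc (hs i).
  rewrite !addr0 -hx => e _; apply: (mulfI s20).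
  by rewrite !mulrBr !mulVKf//; lra.
have cy0 i j : cy 0 i = cy 0 j.
  apply: (ordS_invariant (f := cy 0)) => {}i; rewrite /cy.
  have [_ _ _ hy _] := rc i; have [_] := chord 0 hX rc (hs i).
  rewrite !addr0 -hy => e; apply: (mulfI s20).
  by rewrite !mulrDr !mulVKf//; lra.
have cxt i (t : R) : 0 <= t -> cx t i = cx 0 i.
  move: t; apply: (derive0_constant (f := fun t => cx t i)) => t t0.
  have [xi' _ /(_ i)[dx _ _]] := cl t t0.
  apply: is_derive_eq (is_derive_subf dx (is_derive_mulf
    (is_derive_constf _ t) (is_derive_sinf (dh t i t0)))) _.
  by field.
have cyt i (t : R) : 0 <= t -> cy t i = cy 0 i.
  move: t; apply: (derive0_constant (f := fun t => cy t i)) => t t0.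
  have [xi' _ /(_ i)[_ dy _]] := cl t t0.
  apply: is_derive_eq (is_derive_addf dy (is_derive_mulf
    (is_derive_constf _ t) (is_derive_cosf (dh t i t0)))) _.
  by field.
pose i0 := Ordinal n0.
exists (cx 0 i0), (cy 0 i0), `|(2 * s)^-1|; split.
  by rewrite normr_gt0 invr_eq0.
(* The polar angle seen from the centre is a quarter turn behind the heading if [s > 0] and ahead of
   it if [s < 0]. *)
move=> i; exists (heading (q 0) i - Num.sg s * (pi / 2)) => t t0.
have e : heading (q 0) i - Num.sg s * (pi / 2) + 2 * v * s * t =
    heading (q t) i - Num.sg s * (pi / 2).
  by rewrite (heading_linear (fun u => dh u i) t0); lra.
rewrite e -(cx0 i) -(cy0 i) -(cxt i t t0) -(cyt i t t0) /cx /cy.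
case: (ltrgtP s 0) s0 => // hs0 _.
  rewrite ltr0_norm ?invr_lt0 ?pmulr_rlt0// ltr0_sg// mulN1r opprK.
  by rewrite cosDpihalf sinDpihalf; split; ring.
rewrite gtr0_norm ?invr_gt0 ?pmulr_rgt0// gtr0_sg// mul1r.
by rewrite cosBpihalf sinBpihalf; split; ring.
Qed.

(** With [s = 0], [chord] makes all headings agree modulo [2 * pi], and [sin alpha = 0] puts each
    link along the common heading. *)
Lemma collinear_of_heading (R : realType) (n : nat) (v k : R)
    (xi : 'M[R]_(n, 3)) (q : R -> config R n) :
  (0 < n)%N -> Xi xi ->
  (forall i : 'I_n, sin (alpha xi i) / rho xi i = 0) ->
  closed_loop v k q -> relcoords (q 0) xi ->
  (forall (t : R) (i : 'I_n), 0 <= t ->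
    is_derive t 1 (fun u : R => heading (q u) i) 0) ->
  collinear_formation v q.
Proof.
move=> n0 hX hs cl rc dh; pose i0 := Ordinal n0.
pose th := heading (q 0) i0.
have ht i (t : R) : 0 <= t -> heading (q t) i = heading (q 0) i.
  by move=> t0; rewrite (heading_linear (fun u => dh u i) t0) mul0r addr0.
have sth i : sin (heading (q 0) i) = sin th.
  apply: (ordS_invariant (f := fun i => sin (heading (q 0) i))) => {}i.
  have [] := chord 0 hX rc (hs i).
  by rewrite !addr0 mulr0 mul0r => /eqP; rewrite subr_eq0 => /eqP.
have cth i : cos (heading (q 0) i) = cos th.
  apply: (ordS_invariant (f := fun i => cos (heading (q 0) i))) => {}i.
  have [_] := chord 0 hX rc (hs i).
  by rewrite !addr0 mulr0 mul0r oppr0 => /eqP; rewrite subr_eq0 => /eqP.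
(* The offset normal to the common heading is shared, so all vehicles lie on one line. *)
have cross i : ypos (q 0) i * cos th - xpos (q 0) i * sin th =
    ypos (q 0) i0 * cos th - xpos (q 0) i0 * sin th.
  apply: (ordS_invariant (f := fun i =>
    ypos (q 0) i * cos th - xpos (q 0) i * sin th)) => {}i.
  have /relcoordsP/(_ i)[r0 _] := rc; rewrite /lft cth sth => e _ _.
  have sa : sin (alpha xi i) = 0.
    by move: (hs i) => /eqP; rewrite mulf_eq0 invr_eq0 (gt_eqF r0) orbF => /eqP.
  by move: e; rewrite sa mulr0; lra.
have xt i (t : R) : 0 <= t -> xpos (q t) i = xpos (q 0) i + v * cos th * t.
  move=> t0; have : xpos (q t) i - v * cos th * t =
      xpos (q 0) i - v * cos th * 0.
    move: t t0.
    apply: (derive0_constant (f := fun u => xpos (q u) i - v * cos th * u)) => u u0.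
    have [xi' _ /(_ i)[dx _ _]] := cl u u0.
    apply: is_derive_eq (is_derive_subf dx (is_derive_mulf
      (is_derive_constf (v * cos th) u) (is_derive_id u 1))) _.
    by rewrite ht// cth; ring.
  by rewrite mulr0 subr0 => <-; rewrite subrK.
have yt i (t : R) : 0 <= t -> ypos (q t) i = ypos (q 0) i + v * sin th * t.
  move=> t0; have : ypos (q t) i - v * sin th * t =
      ypos (q 0) i - v * sin th * 0.
    move: t t0.
    apply: (derive0_constant (f := fun u => ypos (q u) i - v * sin th * u)) => u u0.
    have [xi' _ /(_ i)[_ dy _]] := cl u u0.
    apply: is_derive_eq (is_derive_subf dy (is_derive_mulf
      (is_derive_constf (v * sin th) u) (is_derive_id u 1))) _.
    by rewrite ht// sth; ring.
  by rewrite mulr0 subr0 => <-; rewrite subrK.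
exists (xpos (q 0) i0), (ypos (q 0) i0), th => i.
pose dx := xpos (q 0) i - xpos (q 0) i0; pose dy := ypos (q 0) i - ypos (q 0) i0.
have crossd : dy * cos th - dx * sin th = 0.
  by have := cross i; rewrite /dx /dy; lra.
have e := cos2Dsin2 th.
(* The component along the line of the initial displacement from vehicle 0; the normal component
   vanishes by [crossd]. *)
exists (dx * cos th + dy * sin th) => t t0; rewrite xt// yt//; split.
- suff : dx = (dx * cos th + dy * sin th) * cos th by rewrite /dx; lra.
  rewrite -[LHS]mulr1 -e -[RHS]addr0 -(mulr0 (- sin th)) -crossd; ring.
- suff : dy = (dx * cos th + dy * sin th) * sin th by rewrite /dy; lra.
  rewrite -[LHS]mulr1 -e -[RHS]addr0 -(mulr0 (cos th)) -crossd; ring.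
- by apply/eqmod2piP; rewrite ht.
Qed.

Unset Implicit Arguments.
Set Strict Implicit.

Theorem theorem13 (R : realType) (n : nat) (v k : R)
    (hn : (2 <= n)%N) (hv : 0 < v) (hk : k != 0) :
  @equilibria R n v k = @Xi R n /\
  forall (xi : 'M[R]_(n, 3)) (s : R), Xi xi ->
    (forall i : 'I_n, sin (alpha xi i) / rho xi i = s) ->
    (exists q : R -> config R n, closed_loop v k q /\ relcoords (q 0) xi) /\
    (forall q : R -> config R n, closed_loop v k q -> relcoords (q 0) xi ->
      [/\ forall t : R, 0 <= t -> relcoords (q t) xi,
          forall (t : R) (i : 'I_n), 0 <= t ->
            is_derive t 1 (fun u : R => heading (q u) i) (2 * v * s),
          s != 0 -> circular_formation (2 * v * s) q,
          (0 < s -> counterclockwise_circular_formation q) /\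
          (s < 0 -> clockwise_circular_formation q)
        & s = 0 -> collinear_formation v q]).
Proof.
have n0 : (0 < n)%N by exact: ltnW.
split; first exact: equilibriaE.
move=> xi s hX hs; split; first exact: exists_closed_loop hX hs.
move=> q cl rc; have inv := relcoords_invariant hv hX hs cl rc.
have dh (t : R) (i : 'I_n) : 0 <= t ->
    is_derive t 1 (fun u : R => heading (q u) i) (2 * v * s).
  by move=> t0; exact: heading_derive hX (hs i) cl t0 (inv t t0).
have circ : s != 0 -> circular_formation (2 * v * s) q.
  by move=> s0; exact: circular_of_heading n0 hv s0 hX hs cl rc dh.
have v2 : 0 < 2 * v by rewrite mulr_gt0.
split=> //.
- split=> s0; exists (2 * v * s).
  + by rewrite mulr_gt0.
  + by apply: circ; rewrite gt_eqF.
  + by rewrite pmulr_rlt0.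
  + by apply: circ; rewrite lt_eqF.
- move=> s0; rewrite s0 ?mulr0 in hs dh.
  exact: collinear_of_heading n0 hX hs cl rc dh.
Qed.
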